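(* Let $f$ be a monic complex polynomial of degree $n \ge 2$. Suppose there exist $1 \le p \le \infty$ and a point $z^0 = (z_1^0,\ldots,z_n^0)$ in $\mathbb{C}^n$ with distinct components such that $$E(z^0) < 1/2^{1/q} \quad\text{and}\quad \phi(E(z^0)) < 1,$$ where $q$ is defined by $1/p + 1/q = 1$ and $\phi$ is the real function defined on $[0,1/2^{1/q})$ by $$\phi(x) = \frac{(n - 1)^{1/q} x}{(1 - x)(1 - 2^{1/q} x)} \left(1 + \frac{x}{(n - 1)^{1/p} (1 - 2^{1/q} x)} \right)^{n - 1}.$$ Then the following statements hold true. 1. The polynomial $f$ has only simple zeros. 2. The closed disks $$D_i = \{z \in \mathbb{C} : |z-(z_i^0 - W_i(z^0))| \le C \, |W_i(z^0)| \}, \quad i = 1,2, \ldots, n,$$ where $C= \theta \lambda / (1 - \theta \lambda^2)$, $\lambda = \phi(E(z^0))$, $\theta = 1-2^{1/q} E(z^0)$, are mutually disjoint and each of them contains exactly one zero of $f$.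
   Context: $\|z\|_p = \left(\sum_{i=1}^n |z_i|^p\right)^{1/p}$ is the usual $p$-norm on $\mathbb{C}^n$ (maximum norm for $p=\infty$), and $1/\infty = 0$. For a point $z=(z_1,\ldots,z_n) \in \mathbb{C}^n$ with distinct components, set, for $i=1,\ldots,n$, $$W_i(z) = \frac{f(z_i)}{\prod_{j \ne i}(z_i - z_j)}, \qquad d_i(z) = \min\{|z_i - z_j| : j \ne i\},$$ $$\frac{W(z)}{d(z)} = \left(\frac{W_1(z)}{d_1(z)}, \ldots, \frac{W_n(z)}{d_n(z)}\right), \qquad E(z) = \left\| \frac{W(z)}{d(z)} \right\|_p .$$ *)

(* Defs.v *)
From HB Require Import structures.
From mathcomp Require Import all_boot all_order all_algebra.
From mathcomp Require Import all_classical all_reals all_analysis.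
From mathcomp Require Export complex.

Set Implicit Arguments.
Unset Strict Implicit.
Unset Printing Implicit Defensive.

Import Order.TTheory GRing.Theory Num.Theory.
Import ComplexField.Normc.

Local Open Scope classical_set_scope.
Local Open Scope ring_scope.
Local Open Scope complex_scope.

(* [normc : R[i] -> R] is used throughout for the modulus: it is the
   [R]-valued version of [`|z|], which lives in [R[i]]. *)

(* The value at [p = -oo] is a dummy; the norm is only used for [1 <= p]. *)
Definition pnorm (R : realType) (n : nat) (p : \bar R) (z : 'rV[R[i]]_n) : R :=
  match p with
  | p%:E => (\sum_(i < n) normc (z 0 i) `^ p) `^ (1 / p)
  | +oo%E => \big[Num.max/0]_(i < n) normc (z 0 i)
  | -oo%E => 0
  end.

(* [1 / p] as a real number, with [1 / +oo = 0]. *)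
Definition recip (R : realType) (p : \bar R) : R := fine (p^-1)%E.

Definition weierstrass (R : realType) (n : nat) (f : {poly R[i]})
    (z : 'rV[R[i]]_n) (i : 'I_n) : R[i] :=
  f.[z 0 i] / \prod_(j < n | j != i) (z 0 i - z 0 j).

(* The minimum is taken in [\bar R], whose top [+oo] is neutral for [min]; it
   is finite as soon as [2 <= n]. *)
Definition sep (R : realType) (n : nat) (z : 'rV[R[i]]_n) (i : 'I_n) : R :=
  fine (\big[Order.min/+oo%E]_(j < n | j != i) (normc (z 0 i - z 0 j))%:E).

Definition Efun (R : realType) (n : nat) (p : \bar R) (f : {poly R[i]})
    (z : 'rV[R[i]]_n) : R :=
  pnorm p (\row_(i < n) (weierstrass f z i / (sep z i)%:C)).

(* [p] and [q] are the conjugate exponents. *)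
Definition phi (R : realType) (n : nat) (p q : \bar R) (x : R) : R :=
  (n.-1%:R `^ recip q * x) / ((1 - x) * (1 - 2 `^ recip q * x)) *
  (1 + x / (n.-1%:R `^ recip p * (1 - 2 `^ recip q * x))) ^+ n.-1.

Definition closed_disk (R : realType) (c : R[i]) (r : R) : set R[i] :=
  [set z | normc (z - c) <= r].

Definition only_simple_zeros (R : realType) (f : {poly R[i]}) : Prop :=
  forall x : R[i], root f x -> mup x f = 1%N.

(* Main.v *)
Require Import Defs.
From mathcomp Require Import all_boot all_order all_algebra.
From mathcomp Require Import all_classical all_reals all_analysis complex.
From mathcomp Require Import ring lra.
Import Order.TTheory GRing.Theory Num.Theory.
Import ComplexField.Normc.
Set Implicit Arguments.
Unset Strict Implicit.
Unset Printing Implicit Defensive.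
Local Open Scope classical_set_scope.
Local Open Scope ring_scope.

(** The roots are found by the Weierstrass iteration [z' i = z i - W i], started
at [z0].  Write [E] for [Efun p f z0], [K] for [2^(1/q)], and [theta], [lambda],
[C] as in the theorem.

One step is analysed as follows.  Hoelder's inequality [ler_sum_pnorm] on pairs
of indices gives [|W i| + |W j| <= K E |z i - z j|], so distances between points
shrink at most by the factor [theta] ([step_dist]).  Interpolating [f] at the
points [z] gives a closed form of the next correction ([weierstrass_stepE]) which
contains [W i] and, besides it, a sum of further corrections.  Hoelder's
inequality and the inequality of arithmetic and geometric means then bound it by
[gain E * |W i|], where [gain E = theta * lambda] ([weierstrass_step_le]).
Dividing by the new separations, one step multiplies [E] by at most [lambda]
([step_Efun]).

Since [gain x / x] is nondecreasing, every step after the first one multiplies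
the corrections by at most [mu = theta * lambda^2 < 1].  Hence all iterates
stay within [theta * lambda * (1 + mu + mu^2 + ...) * |W i| = C * |W i|] of the
first one, that is, in the disk [D i] ([iter_dist_le]), and [f] tends to [0]
along them.  As [f] is a product of linear factors, [D i] must contain a root
([root_in_disk]).

The disks are disjoint because their centres are at distance at least
[theta * |z i - z j|] while their radii add up to at most
[C * K * E * |z i - z j|], and [C * (1 - theta) < theta] ([disks_disjoint]).
So there are [n] disjoint disks, each containing a root of a polynomial of
degree [n]: these are all the roots, they are simple, and each disk contains
exactly one of them. *)

(** * Modulus of complex numbers *)

Section Modulus.
Variable R : realType.
Implicit Types x y : R[i].

Lemma normc_ge0 x : 0 <= normc x.
Proof. by case: x => a b; exact: sqrtr_ge0. Qed.

Lemma normc_gt0 x : (0 < normc x) = (x != 0).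
Proof.
rewrite lt_def normc_ge0 andbT; congr (~~ _).
by apply/eqP/eqP => [/eq0_normc|->] //; exact: normc0.
Qed.

Lemma normc_opp x : normc (- x) = normc x.
Proof. exact: normcN. Qed.

Lemma normc_distC x y : normc (x - y) = normc (y - x).
Proof. by rewrite -normc_opp opprB. Qed.

Lemma ler_normc_add x y : normc (x + y) <= normc x + normc y.
Proof. exact: le_normcD. Qed.

Lemma ler_normc_sub x y : normc (x - y) <= normc x + normc y.
Proof. by rewrite -(normc_opp y) ler_normc_add. Qed.

Lemma ler_sub_normc x y : normc x - normc y <= normc (x - y).
Proof. by rewrite lerBlDr -{1}(subrK y x) ler_normc_add. Qed.

Lemma normc_real (r : R) : 0 <= r -> normc (r%:C)%C = r.
Proof. by move=> r0; rewrite /normc /= expr0n /= addr0 sqrtr_sqr ger0_norm. Qed.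

Lemma normc_div_real x (r : R) : 0 <= r -> normc (x / (r%:C)%C) = normc x / r.
Proof. by move=> r0; rewrite normcM normcV normc_real. Qed.

Lemma normc_prod (I : Type) (s : seq I) (P : pred I) (F : I -> R[i]) :
  normc (\prod_(i <- s | P i) F i) = \prod_(i <- s | P i) normc (F i).
Proof. by apply: (big_morph _ (@normcM R)); rewrite normc1. Qed.

Lemma ler_normc_sum (I : Type) (s : seq I) (P : pred I) (F : I -> R[i]) :
  normc (\sum_(i <- s | P i) F i) <= \sum_(i <- s | P i) normc (F i).
Proof.
elim/big_rec2: _ => [|i u v _ vu]; first by rewrite normc0.
by apply: le_trans (ler_normc_add _ _) _; rewrite lerD2l.
Qed.

End Modulus.

(** * Hoelder's inequality for the p-norm *)

Section PNorm.
Variables (R : realType) (n : nat) (p : \bar R).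
Hypothesis p1 : (1 <= p)%E.
Implicit Types u v : 'rV[R[i]]_n.

Lemma pnorm_ge0 u : 0 <= pnorm p u.
Proof.
case: p => [r||] //=; first exact: powR_ge0.
by elim/big_rec: _ => // i x _ x0; rewrite le_max x0 orbT.
Qed.

(** Monotonicity and homogeneity at once: this is how a componentwise bound
    by a factor [c] passes to the functional [Efun]. *)
Lemma ler_pnorm u v (c : R) : 0 <= c ->
  (forall i, normc (u 0 i) <= c * normc (v 0 i)) -> pnorm p u <= c * pnorm p v.
Proof.
move=> c0 uv; case: p p1 => [r||] //=.
- rewrite lee_fin => r1; have r0 : 0 < r by apply: lt_le_trans r1.
  have -> : c = (c `^ r) `^ (1 / r).
    by rewrite -powRrM mulrC divfK ?gt_eqF// powRr1.
  rewrite -powRM ?powR_ge0 ?sumr_ge0// => [|i _]; last exact: powR_ge0.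
  apply: ge0_ler_powR; first by rewrite divr_ge0// ltW.
  - by rewrite nnegrE sumr_ge0// => i _; exact: powR_ge0.
  - by rewrite nnegrE mulr_ge0 ?powR_ge0// sumr_ge0// => i _; exact: powR_ge0.
  rewrite mulr_sumr ler_sum// => i _; rewrite -powRM ?normc_ge0//.
  by apply: ge0_ler_powR; rewrite ?(ltW r0) ?nnegrE ?mulr_ge0 ?normc_ge0.
- move=> _; apply/bigmax_leP; split.
    by rewrite mulr_ge0 ?bigmax_ge_id.
  move=> i _; apply: le_trans (uv i) _; rewrite ler_wpM2l//.
  exact: (le_bigmax _ (fun j => normc (v 0 j))).
Qed.

Lemma recip_conj (q : \bar R) : (p^-1 + q^-1 = 1)%E -> recip q = 1 - recip p.
Proof.
rewrite /recip; have : (p^-1)%E \is a fin_num.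
  case: p p1 => [r||] //; rewrite lee_fin => r1.
  by rewrite inver gt_eqF//; apply: lt_le_trans r1.
case: (p^-1)%E => [s||] // _; case: (q^-1)%E => [t||] //= [] <-.
by rewrite addrAC subrr add0r.
Qed.

Lemma recip_le1 : recip p <= 1.
Proof.
case: p p1 => [r||] //=; rewrite /recip ?invey//= ?ler01// lee_fin => r1.
have r0 : 0 < r by apply: lt_le_trans r1.
by rewrite inver gt_eqF//= invf_le1.
Qed.

(** Bernoulli's inequality for real exponents, as the case [b = 1] of Young's
    inequality [t * b <= t^r / r + b^r' / r'] with [r'] conjugate to [r]. *)
Lemma bernoulli_powR (r t : R) : 1 <= r -> 0 <= t -> 1 + r * (t - 1) <= t `^ r.
Proof.
rewrite le_eqVlt => /predU1P[<-|r1] t0; first by rewrite powRr1// mul1r subrKC.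
have r0 : 0 < r by apply: lt_trans r1.
have := @conjugate_powR R t 1 r (1 - r^-1)^-1 t0 ler01 r0.
rewrite invrK powR1 mulr1 mul1r invr_gt0 subr_gt0 invf_lt1// r1 => /(_ erefl).
rewrite subrKC => /(_ erefl) h.
have : r * t <= r * (t `^ r / r + (1 - r^-1)) by rewrite ler_pM2l.
by rewrite mulrDr mulrCA mulrBr mulr1 !divff ?gt_eqF// mulr1; lra.
Qed.

(** Hoelder's inequality against the indicator of [A].  For a finite exponent
    [r] it is the power mean inequality: the tangent to [t^r] at [1], given by
    [bernoulli_powR], is summed over the entries divided by their mean, where
    the linear terms cancel. *)
Lemma ler_sum_pnorm u (A : {pred 'I_n}) :
  \sum_(i in A) normc (u 0 i) <= #|A|%:R `^ (1 - recip p) * pnorm p u.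
Proof.
have S0 : 0 <= \sum_(i in A) normc (u 0 i).
  by rewrite sumr_ge0// => i _; exact: normc_ge0.
have [|m0] := posnP #|A|.
  move=> /card0_eq A0; rewrite big_pred0// mulr_ge0 ?powR_ge0//.
  exact: pnorm_ge0.
have mR0 : 0 < #|A|%:R :> R by rewrite ltr0n.
case: p p1 => [r||] //=.
- rewrite lee_fin => r1; have r0 : 0 < r by apply: lt_le_trans r1.
  rewrite /recip inver gt_eqF//= div1r.
  set S := \sum_(i in A) _ in S0 *; set m : R := #|A|%:R.
  have T0 : 0 <= \sum_(i < n) normc (u 0 i) `^ r.
    by rewrite sumr_ge0// => i _; exact: powR_ge0.
  have [->|SN0] := eqVneq S 0; first by rewrite mulr_ge0 ?powR_ge0.
  have Sp : 0 < S by rewrite lt_def SN0.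
  suff SrT : S `^ r <= m `^ (r - 1) * \sum_(i < n) normc (u 0 i) `^ r.
    have -> : S = (S `^ r) `^ r^-1 by rewrite -powRrM divff ?gt_eqF// powRr1.
    have -> : 1 - r^-1 = (r - 1) * r^-1 by rewrite mulrBl mul1r divff ?gt_eqF.
    rewrite powRrM -powRM ?powR_ge0//.
    by apply: ge0_ler_powR; rewrite ?invr_ge0 ?nnegrE ?mulr_ge0 ?powR_ge0 ?(ltW r0).
  (* [c] is the inverse of the mean of the entries in [A]. *)
  set c := m / S; have c0 : 0 < c by rewrite divr_gt0.
  have mcT : m <= (\sum_(i in A) normc (u 0 i) `^ r) * c `^ r.
    rewrite mulr_suml; apply: le_trans
      (_ : _ <= \sum_(i in A) (1 + r * (normc (u 0 i) * c - 1))) _.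
      rewrite big_split/= -mulr_sumr sumrB -mulr_suml -/S !sumr_const.
      by rewrite -/m mulrCA divff// mulr1 subrr mulr0 addr0.
    apply: ler_sum => i _; rewrite -powRM ?normc_ge0 ?(ltW c0)//.
    by apply: bernoulli_powR; rewrite // mulr_ge0 ?normc_ge0 ?ltW.
  have sub : \sum_(i in A) normc (u 0 i) `^ r <= \sum_(i < n) normc (u 0 i) `^ r.
    by rewrite [leRHS](bigID (mem A))/= lerDl sumr_ge0// => i _; exact: powR_ge0.
  have cS : c `^ r * S `^ r = m * m `^ (r - 1).
    by rewrite -powRM ?ltW// divfK ?gt_eqF// mulr_powRB1// ltW.
  rewrite -(@ler_pM2l _ m)// mulrA -cS -mulrA.
  apply: le_trans (ler_wpM2r (powR_ge0 _ _) mcT) _.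
  by rewrite [leRHS]mulrA [leRHS]mulrC -mulrA ler_wpM2r ?mulr_ge0 ?powR_ge0.
- move=> _; rewrite /recip invey /= subr0 powRr1 ?ler0n//.
  rewrite mulr_natl -sumr_const ler_sum// => i _.
  exact: (le_bigmax _ (fun j => normc (u 0 j))).
Qed.

End PNorm.

(** * Separation of the points *)

Section Separation.
Variables (R : realType) (n : nat) (z : 'rV[R[i]]_n).
Hypothesis n2 : (2 <= n)%N.

(** The extended-real minimum defining [sep] has [+oo] as its neutral element,
    and a second index [j] is what keeps it finite. *)
Lemma sep_attained i : exists2 j, j != i & sep z i = normc (z 0 i - z 0 j).
Proof.
have [j ji] : exists j, j != i.
  have : (0 < #|predC1 i|)%N by rewrite cardC1 card_ord -subn1 subn_gt0.
  by case/card_gt0P => j; exists j.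
rewrite /sep.
have [|k ki ->] := @eq_bigmin _ _ _ +oo%E j (fun j => j != i)
  (fun j => (normc (z 0 i - z 0 j))%:E) ji; last by exists k.
by move=> k _; rewrite leey.
Qed.

Lemma sep_le i j : j != i -> sep z i <= normc (z 0 i - z 0 j).
Proof.
move=> ji; rewrite /sep.
have [|k ki e] := @eq_bigmin _ _ _ +oo%E j (fun j => j != i)
  (fun j => (normc (z 0 i - z 0 j))%:E) ji; first by move=> k _; rewrite leey.
rewrite e /= -lee_fin -e.
exact: (bigmin_le_cond _ (fun j => (normc (z 0 i - z 0 j))%:E)).
Qed.

Hypothesis zinj : injective (fun i : 'I_n => z 0 i).

Lemma sep_gt0 i : 0 < sep z i.
Proof.
have [j ji ->] := sep_attained i; rewrite normc_gt0 subr_eq0.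
by apply: contra ji => /eqP/zinj ->.
Qed.

End Separation.

(** * Lagrange interpolation *)

Lemma size_prod_XsubC_cond (F : fieldType) (I : finType) (P : pred I)
    (x : I -> F) : size (\prod_(i | P i) ('X - (x i)%:P)) = #|P|.+1.
Proof.
rewrite size_prod => [|i _]; last by rewrite polyXsubC_eq0.
under eq_bigr do rewrite size_XsubC.
by rewrite sum_nat_const muln2 -addnn subSn ?leq_addr// addnK.
Qed.

Section Lagrange.
Variables (F : fieldType) (n : nat) (f : {poly F}) (x : 'I_n -> F).
Hypotheses (fmonic : f \is monic) (fsize : size f = n.+1) (xinj : injective x).

(** Lagrange interpolation in Weierstrass form: the two sides are monic of
    degree [n], so their difference has degree less than [n], and it vanishes
    at the [n] distinct nodes. *)
Lemma monic_lagrange :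
  f = \prod_j ('X - (x j)%:P) +
      \sum_j (f.[x j] / \prod_(k | k != j) (x j - x k)) *:
               \prod_(k | k != j) ('X - (x k)%:P).
Proof.
set L := _ + _.
have sP : size (\prod_j ('X - (x j)%:P)) = n.+1.
  by rewrite size_prod_XsubC_cond card_ord.
apply/eqP; rewrite -subr_eq0; apply/eqP.
apply: (@roots_geq_poly_eq0 _ _ (map x (enum 'I_n))).
- apply/allP => _ /mapP[i _ ->]; rewrite /root /L hornerD hornerN hornerD horner_sum.
  rewrite horner_prod (bigD1 i)//= hornerXsubC subrr mul0r add0r.
  rewrite (bigD1 i)//= [X in _ - (_ + X)]big1 ?addr0 => [|j ji]; last first.
    rewrite hornerZ horner_prod [X in _ * X](bigD1 i) 1?eq_sym//=.
    by rewrite hornerXsubC subrr mul0r mulr0.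
  rewrite hornerZ horner_prod.
  under [X in _ / _ * X]eq_bigr do rewrite hornerXsubC.
  rewrite divfK ?subrr//; apply/prodf_neq0 => j ji.
  by rewrite subr_eq0; apply: contra ji => /eqP/xinj ->.
- by rewrite map_inj_uniq ?enum_uniq.
- rewrite size_map size_enum_ord /L opprD addrA.
  apply: leq_trans (size_polyD _ _) _; rewrite geq_max; apply/andP; split.
    apply/leq_sizeP => j; rewrite coefB leq_eqVlt => /predU1P[<-|nj].
      have := monicP fmonic; rewrite /lead_coef fsize /= => ->.
      have := monicP (monic_prod_XsubC (index_enum 'I_n) predT x).
      by rewrite /lead_coef sP /= => ->; rewrite subrr.
    by rewrite !nth_default ?subrr ?sP ?fsize.
  rewrite size_polyN; apply: leq_trans (size_sum _ _ _) _.
  apply/bigmax_leqP => j _; apply: leq_trans (size_scale_leq _ _) _.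
  rewrite size_prod_XsubC_cond cardC1 card_ord.
  by rewrite prednK// (leq_trans _ (ltn_ord j)).
Qed.

End Lagrange.

(** * The gain function *)

Definition weierstrass_step (R : realType) (n : nat) (f : {poly R[i]})
    (z : 'rV[R[i]]_n) : 'rV[R[i]]_n :=
  \row_i (z 0 i - weierstrass f z i).

(** [gain n p (Efun p f z)] bounds the factor by which one Weierstrass step
    shrinks each correction [weierstrass f z i].  It is [phi] without the factor
    [1 / (1 - 2^(1/q) x)], which accounts for the loss of separation, and with
    [1 / q] written as [1 - 1 / p]. *)
Definition gain (R : realType) (n : nat) (p : \bar R) (x : R) : R :=
  n.-1%:R `^ (1 - recip p) * x / (1 - x) *
  (1 + x / (n.-1%:R `^ recip p * (1 - 2 `^ (1 - recip p) * x))) ^+ n.-1.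

Lemma gain_ge0 (R : realType) (n : nat) (p : \bar R) (x : R) :
  0 <= x -> x < 1 -> 2 `^ (1 - recip p) * x < 1 -> 0 <= gain n p x.
Proof.
move=> x0 /ltW x1 /ltW kx1; apply: mulr_ge0.
  by rewrite divr_ge0 ?mulr_ge0 ?powR_ge0 ?subr_ge0.
by rewrite exprn_ge0// addr_ge0// divr_ge0// mulr_ge0 ?powR_ge0// subr_ge0.
Qed.

(** [gain] is [x] times a nondecreasing function.  Taking [c < 1] shows that
    the shrinking factor itself shrinks along the iteration. *)
Lemma ler_gain (R : realType) (n : nat) (p : \bar R) (c x y : R) :
  0 <= c <= 1 -> 0 <= x -> 0 <= y <= c * x -> x < 1 -> 2 `^ (1 - recip p) * x < 1 ->
  gain n p y <= c * gain n p x.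
Proof.
rewrite /gain; set K := 2 `^ _; set a := _ `^ _; set b := _ `^ _ => /andP[c0 c1].
have [K0 a0 b0] : [/\ 0 <= K, 0 <= a & 0 <= b] by split; exact: powR_ge0.
move=> x0 /andP[y0 ycx] x1 Kx1.
have yx : y <= x by rewrite (le_trans ycx)// ler_piMl.
have Ky : K * y <= K * x by rewrite ler_wpM2l.
rewrite mulrA; apply: ler_pM.
- by rewrite divr_ge0 ?mulr_ge0// subr_ge0 (le_trans yx)// ltW.
- rewrite exprn_ge0// addr_ge0// divr_ge0// mulr_ge0//.
  by rewrite subr_ge0 (le_trans Ky)// ltW.
- rewrite mulrA mulrCA ler_pM//.
  + by rewrite mulr_ge0.
  + by rewrite invr_ge0 subr_ge0 (le_trans yx)// ltW.
  + by rewrite ler_wpM2l.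
  + by rewrite lef_pV2 ?posrE ?subr_gt0 ?(le_lt_trans yx)// lerD2l lerN2.
- apply: lerXn2r; rewrite ?nnegrE.
  + by rewrite addr_ge0// divr_ge0// mulr_ge0// subr_ge0 (le_trans Ky)// ltW.
  + by rewrite addr_ge0// divr_ge0// mulr_ge0// subr_ge0 ltW.
  rewrite lerD2l !invfM ler_pM// ?mulr_ge0 ?invr_ge0//.
  + by rewrite subr_ge0 (le_trans Ky)// ltW.
  rewrite ler_wpM2l ?invr_ge0// lef_pV2 ?posrE ?subr_gt0 ?(le_lt_trans Ky)//.
  by rewrite lerD2l lerN2.
Qed.

Lemma phi_gain (R : realType) (n : nat) (p q : \bar R) (x : R) :
  (1 <= p)%E -> (p^-1 + q^-1 = 1)%E ->
  phi n p q x = gain n p x / (1 - 2 `^ (1 - recip p) * x).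
Proof.
by move=> p1 pq; rewrite /phi /gain (recip_conj p1 pq) invfM mulrA mulrAC.
Qed.

(** * One step of the Weierstrass method *)

Section Step.
Variables (R : realType) (n : nat) (p : \bar R) (f : {poly R[i]}).
Variable z : 'rV[R[i]]_n.
Hypotheses (n2 : (2 <= n)%N) (p1 : (1 <= p)%E).
Hypotheses (fmonic : f \is monic) (fsize : size f = n.+1).
Hypothesis zinj : injective (fun i : 'I_n => z 0 i).
Let W := weierstrass f z.
Let E := Efun p f z.
(* [K] is [2^(1/q)]. *)
Let K : R := 2 `^ (1 - recip p).
Let z' := weierstrass_step f z.
Hypothesis KE1 : K * E < 1.

Lemma Efun_ge0 : 0 <= E.
Proof. exact: pnorm_ge0. Qed.

Lemma K_ge1 : 1 <= K.
Proof. by rewrite -[leLHS](powRr0 2) ler_powR ?ler1n// subr_ge0 recip_le1. Qed.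

Lemma sum_quotient_le (A : {pred 'I_n}) :
  \sum_(i in A) normc (W i) / sep z i <= #|A|%:R `^ (1 - recip p) * E.
Proof.
apply: le_trans (ler_sum_pnorm p1 _ _); rewrite le_eqVlt; apply/orP; left.
apply/eqP/eq_bigr => i _.
by rewrite mxE normc_div_real// ltW ?sep_gt0.
Qed.

Lemma weierstrass_le i : normc (W i) <= E * sep z i.
Proof.
rewrite -ler_pdivrMr ?sep_gt0//.
by have := sum_quotient_le (pred1 i); rewrite big_pred1_eq card1 powR1 mul1r.
Qed.

(** Hoelder on the two indices [i] and [j] is the origin of [2^(1/q)]: when every
    point moves by its correction, the distance between two of them shrinks at
    most by the factor [1 - 2^(1/q) E]. *)
Lemma weierstrass_pair_le i j : j != i ->
  normc (W i) + normc (W j) <= K * E * normc (z 0 i - z 0 j).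
Proof.
move=> ji; have := sum_quotient_le (pred2 i j).
rewrite card2 eq_sym ji -/K => le2.
have {}le2 : normc (W i) / sep z i + normc (W j) / sep z j <= K * E.
  apply: le_trans le2; rewrite (bigD1 i) ?inE ?eqxx//= (bigD1 j) ?inE ?eqxx ?orbT//=.
  rewrite big_pred0 ?addr0// => k; rewrite !inE.
  by case: (k == i) (k == j) => [] [].
apply: le_trans (ler_wpM2r (normc_ge0 _) le2); rewrite mulrDl.
have wle k d : sep z k <= d -> normc (W k) <= normc (W k) / sep z k * d.
  move=> kd; rewrite -[leLHS](divfK (lt0r_neq0 (sep_gt0 n2 zinj k))).
  by rewrite ler_wpM2l ?divr_ge0 ?normc_ge0// ltW ?sep_gt0.
apply: lerD; apply: wle; first exact: sep_le.
by rewrite normc_distC sep_le// eq_sym.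
Qed.

Lemma Efun_lt1 : E < 1.
Proof. by apply: le_lt_trans KE1; rewrite ler_peMl ?Efun_ge0 ?K_ge1. Qed.

Lemma dist_gt0 i j : j != i -> 0 < normc (z 0 i - z 0 j).
Proof. by move=> ji; apply: lt_le_trans (sep_le z ji); exact: sep_gt0. Qed.

Lemma step_dist i j : j != i ->
  (1 - K * E) * normc (z 0 i - z 0 j) <= normc (z' 0 i - z' 0 j).
Proof.
move=> ji; rewrite !mxE -/W.
have -> : z 0 i - W i - (z 0 j - W j) = z 0 i - z 0 j - (W i - W j) by ring.
apply: le_trans (ler_sub_normc _ _); rewrite mulrBl mul1r lerB//.
exact: le_trans (ler_normc_sub _ _) (weierstrass_pair_le ji).
Qed.

(** A new point is compared here with an old one, so that only one correction
    enters and the factor is [1 - E] instead of [1 - 2^(1/q) E]. *)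
Lemma step_dist_old i j : j != i ->
  (1 - E) * normc (z 0 i - z 0 j) <= normc (z' 0 i - z 0 j).
Proof.
move=> ji; rewrite !mxE -/W addrAC.
apply: le_trans (ler_sub_normc _ _); rewrite mulrBl mul1r lerB//.
apply: le_trans (weierstrass_le i) _.
by rewrite ler_wpM2l ?Efun_ge0// sep_le.
Qed.

Lemma step_dist_gt0 i j : j != i -> 0 < normc (z' 0 i - z' 0 j).
Proof.
move=> ji; apply: lt_le_trans (step_dist ji).
by rewrite mulr_gt0 ?dist_gt0// subr_gt0.
Qed.

Lemma step_dist_old_gt0 i j : j != i -> 0 < normc (z' 0 i - z 0 j).
Proof.
move=> ji; apply: lt_le_trans (step_dist_old ji).
by rewrite mulr_gt0 ?dist_gt0// subr_gt0 Efun_lt1.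
Qed.

Lemma step_inj : injective (fun i : 'I_n => z' 0 i).
Proof.
move=> i j /= ij; apply/eqP; apply: contraT; rewrite eq_sym => /step_dist_gt0.
by rewrite ij subrr normc_gt0 eqxx.
Qed.

Lemma step_sep i : (1 - K * E) * sep z i <= sep z' i.
Proof.
have [j ji ->] := sep_attained z' n2 i; apply: le_trans (step_dist ji).
by rewrite ler_wpM2l ?sep_le// subr_ge0 ltW.
Qed.

(** In the interpolation formula at the new point [z' i], the nodal polynomial
    contributes [- W i] times the product of the [z' i - z j] over [j != i], and
    the [i]-th Lagrange term is the opposite of that.  The other terms all keep
    a factor [W i * W j], whence the quadratic convergence. *)
Lemma weierstrass_stepE i : weierstrass f z' i =
  - W i * (\sum_(j | j != i) W j / (z' 0 i - z 0 j)) *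
  \prod_(j | j != i) ((z' 0 i - z 0 j) / (z' 0 i - z' 0 j)).
Proof.
have nz j : j != i -> z' 0 i - z 0 j != 0.
  by move=> ji; rewrite -normc_gt0 step_dist_old_gt0.
rewrite prodf_div mulrA /weierstrass; congr (_ / _).
have zi : z' 0 i - z 0 i = - W i by rewrite mxE addrAC subrr add0r.
rewrite {1}(monic_lagrange fmonic fsize zinj) hornerD horner_sum horner_prod.
under eq_bigr do rewrite hornerXsubC.
rewrite (bigD1 i)//= [X in _ + X](bigD1 i)//= hornerZ horner_prod.
under [X in _ * _ + (_ * X + _)]eq_bigr do rewrite hornerXsubC.
rewrite zi -[_ / _]/(W i) addrA mulNr addNr add0r.
rewrite mulr_sumr mulr_suml; apply: eq_bigr => j ji.
rewrite hornerZ -[_ / _]/(W j) horner_prod.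
under eq_bigr do rewrite hornerXsubC.
rewrite (bigD1 i) 1?eq_sym//= zi [in RHS](bigD1 j)//=.
rewrite (eq_bigl (fun k => (k != i) && (k != j))); last by move=> k; rewrite andbC.
set Q := \prod_(k | _) _; have := nz j ji.
set d := z' 0 i - z 0 j; move=> d0; by field.
Qed.

(** In [weierstrass_stepE] the sum is controlled by Hoelder on the [n - 1]
    indices [j != i], and the factors of the product are [1 - W j / (z' i - z' j)],
    with moduli at most the [g j] below; the inequality of arithmetic and
    geometric means bounds the product of the [g j] by a power of their mean,
    to which Hoelder applies again. *)
Lemma weierstrass_step_le i :
  normc (weierstrass f z' i) <= gain n p E * normc (W i).
Proof.
have th0 : 0 < 1 - K * E by rewrite subr_gt0.
have E1 : 0 < 1 - E by rewrite subr_gt0 Efun_lt1.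
have cardi : #|predC1 i| = n.-1 by rewrite cardC1 card_ord.
have S := sum_quotient_le (predC1 i); rewrite cardi in S.
set N : R := n.-1%:R in S *.
have N0 : 0 < N by rewrite ltr0n -subn1 subn_gt0.
rewrite weierstrass_stepE 2!normcM normc_opp -mulrA [leLHS]mulrC.
rewrite ler_wpM2r ?normc_ge0// /gain ler_pM ?normc_ge0//.
  apply: le_trans (ler_normc_sum _ _ _) _; rewrite ler_pdivlMr// mulr_suml.
  apply: le_trans S; apply: ler_sum => j ji; rewrite normcM normcV.
  rewrite -mulrA ler_wpM2l ?normc_ge0// ler_pdivrMl ?step_dist_old_gt0//.
  rewrite ler_pdivlMr ?sep_gt0//; apply: le_trans (step_dist_old ji).
  by rewrite ler_pM2l// normc_distC sep_le// eq_sym.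
rewrite normc_prod.
pose g j : R := 1 + normc (W j) / sep z j / (1 - K * E).
have g0 j : 0 <= normc (W j) / sep z j / (1 - K * E).
  by rewrite !divr_ge0 ?normc_ge0// ltW ?sep_gt0.
apply: le_trans (_ : _ <= \prod_(j in predC1 i) g j) _.
  apply: ler_prod => j ji; rewrite normc_ge0/=.
  have -> : (z' 0 i - z 0 j) / (z' 0 i - z' 0 j) = 1 - W j / (z' 0 i - z' 0 j).
    have nz : z' 0 i - z' 0 j != 0 by rewrite -normc_gt0 step_dist_gt0.
    apply: (mulIf nz); rewrite divfK// [RHS]mulrBl mul1r divfK// [z' 0 j]mxE -/W.
    by ring.
  apply: le_trans (ler_normc_sub _ _) _; rewrite normc1 lerD2l normcM normcV.
  rewrite -mulrA ler_wpM2l ?normc_ge0// -invfM.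
  rewrite lef_pV2 ?posrE ?step_dist_gt0//; last first.
    by rewrite mulr_gt0 ?sep_gt0.
  apply: le_trans (step_dist ji).
  by rewrite mulrC ler_pM2l// normc_distC sep_le// eq_sym.
have [] := @Num.Theory.leif_AGM _ _ (predC1 i) g => [j _|].
  by rewrite addr_ge0 ?g0.
rewrite cardi => AGM _; apply: le_trans AGM _.
have Ns : N `^ (1 - recip p) = N / N `^ recip p.
  by rewrite powRB ?powRr1 ?ltW// (gt_eqF N0) implybT.
have Ns0 : 0 < N `^ recip p by rewrite powR_gt0.
have mean0 : 0 <= (\sum_(j in predC1 i) g j) / N.
  by rewrite divr_ge0 ?(ltW N0)// sumr_ge0// => j _; rewrite addr_ge0.
have mean_le : (\sum_(j in predC1 i) g j) / N <=
    1 + E / (N `^ recip p * (1 - K * E)).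
  rewrite big_split/= sumr_const cardi mulrDl divff ?gt_eqF// lerD2l.
  rewrite -mulr_suml ler_pdivrMr// ler_pdivrMr//; apply: le_trans S _.
  rewrite Ns le_eqVlt; apply/orP; left; apply/eqP; field.
  by rewrite !gt_eqF.
by apply: lerXn2r; rewrite ?nnegrE// (le_trans mean0).
Qed.

(** Each correction shrinks by [gain E], while the separation by which it is
    divided shrinks at most by [1 - K * E]. *)
Lemma step_Efun : Efun p f z' <= gain n p E / (1 - K * E) * E.
Proof.
have th0 : 0 < 1 - K * E by rewrite subr_gt0.
apply: ler_pnorm => // [|i].
  by rewrite divr_ge0 ?(ltW th0)// gain_ge0 ?Efun_ge0 ?Efun_lt1.
rewrite !mxE !normc_div_real; try by rewrite ltW ?sep_gt0//; exact: step_inj.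
rewrite mulrACA -invfM ler_pM ?normc_ge0 ?weierstrass_step_le//.
  by rewrite invr_ge0 ltW ?sep_gt0//; exact: step_inj.
by rewrite lef_pV2 ?posrE ?step_sep ?mulr_gt0 ?sep_gt0//; exact: step_inj.
Qed.

End Step.

(** * Locating and counting roots *)

Lemma geometric_small (R : realType) (a m e : R) :
  0 <= m < 1 -> 0 < e -> exists k, a * m ^+ k < e.
Proof.
move=> /andP[m0 m1] e0.
have := @cvg_geometric R a m.
rewrite ger0_norm// => /(_ m1) /cvgrPdist_lt /(_ e e0) [k _ /(_ k (leqnn _))].
rewrite /= sub0r normrN => h; exists k; apply: le_lt_trans h; exact: ler_norm.
Qed.

(** With [f] split into linear factors [X - x], a disk free of roots gives each
    factor a positive lower bound on the disk, hence [f] as well.  Thus a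
    root is found without taking a limit of the points [w]. *)
Lemma root_in_disk (R : realType) (f : {poly R[i]}) (c : R[i]) (r : R) :
  f \is monic ->
  (forall e, 0 < e -> exists2 w, normc (w - c) <= r & normc f.[w] < e) ->
  exists2 x, normc (x - c) <= r & root f x.
Proof.
move=> fmonic small; have [s fs] := closed_field_poly_normal f.
move: fs; rewrite (monicP fmonic) scale1r => fs.
have [/hasP[x xs xr]|/hasPn far] := boolP (has (fun x => normc (x - c) <= r) s).
  by exists x; rewrite // fs root_prod_XsubC.
have [|w wr] := small (\prod_(x <- s) (normc (x - c) - r)).
  by rewrite big_seq; apply: prodr_gt0 => x /far; rewrite -ltNge subr_gt0.
rewrite ltNge => /negP[]; rewrite fs horner_prod normc_prod big_seq [leRHS]big_seq.
apply: ler_prod => x /far; rewrite -ltNge => /ltW xr; rewrite subr_ge0 xr/=.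
rewrite hornerXsubC lerBlDr.
have -> : x - c = (w - c) - (w - x) by ring.
apply: le_trans (ler_normc_sub _ _) _; rewrite addrC lerD2l//.
Qed.

Lemma distinct_roots_only (F : fieldType) (n : nat) (f : {poly F}) (x : 'I_n -> F) :
  f \is monic -> size f = n.+1 -> injective x -> (forall i, root f (x i)) ->
  forall y, root f y -> mup y f = 1%N /\ exists i, y = x i.
Proof.
move=> fmonic fsize xinj xroot y fy.
have us : uniq (map x (enum 'I_n)) by rewrite map_inj_uniq ?enum_uniq.
have fE : f = \prod_(z <- map x (enum 'I_n)) ('X - z%:P).
  rewrite -[RHS]scale1r -(monicP fmonic); apply: all_roots_prod_XsubC.
  - by rewrite size_map size_enum_ord.
  - by apply/allP => _ /mapP[i _ ->].
  - by rewrite uniq_rootsE.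
have ys : y \in map x (enum 'I_n) by rewrite -root_prod_XsubC -fE.
split; last by have /mapP[i _ ->] := ys; exists i.
by rewrite fE mu_prod_XsubC count_uniq_mem// ys.
Qed.

(** * The iteration and its disks *)

Section Iteration.
Variables (R : realType) (n : nat) (p : \bar R) (f : {poly R[i]}).
Variable z0 : 'rV[R[i]]_n.
Hypotheses (n2 : (2 <= n)%N) (p1 : (1 <= p)%E).
Hypotheses (fmonic : f \is monic) (fsize : size f = n.+1).
Hypothesis zinj : injective (fun i : 'I_n => z0 0 i).
Let W := weierstrass f z0.
Let E := Efun p f z0.
Let K : R := 2 `^ (1 - recip p).
Let theta := 1 - K * E.
Let lambda := gain n p E / theta.
Hypotheses (KE1 : K * E < 1) (lambda1 : lambda < 1).
Let it k := iter k (weierstrass_step f) z0.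
Let mu := theta * lambda ^+ 2.
Let C := theta * lambda / (1 - mu).

Lemma theta_gt0 : 0 < theta. Proof. by rewrite subr_gt0. Qed.

Lemma theta_le1 : theta <= 1.
Proof. by rewrite lerBlDr lerDl mulr_ge0 ?powR_ge0 ?Efun_ge0. Qed.

Lemma lambda_ge0 : 0 <= lambda.
Proof.
by rewrite divr_ge0 ?(ltW theta_gt0)// gain_ge0 ?Efun_ge0 ?Efun_lt1.
Qed.

Lemma mu_ge0 : 0 <= mu.
Proof. by rewrite mulr_ge0 ?(ltW theta_gt0)// exprn_ge0 ?lambda_ge0. Qed.

Lemma mu_lt1 : mu < 1.
Proof.
apply: le_lt_trans (_ : lambda ^+ 2 < 1); last by rewrite exprn_ilt1 ?lambda_ge0.
by rewrite ler_piMl ?theta_le1// exprn_ge0 ?lambda_ge0.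
Qed.

Lemma C_ge0 : 0 <= C.
Proof.
apply: divr_ge0; first by rewrite mulr_ge0 ?lambda_ge0 ?(ltW theta_gt0).
by rewrite subr_ge0 ltW ?mu_lt1.
Qed.

Lemma gainE : gain n p E = theta * lambda.
Proof. by rewrite mulrC divfK// gt_eqF ?theta_gt0. Qed.

(** The exponent is [0] at the start and [1] afterwards: although [Efun] in fact
    tends to [0], the one factor [lambda] already yields the constant [C]. *)
Lemma iter_invariant k :
  injective (fun i : 'I_n => it k 0 i) /\
  Efun p f (it k) <= lambda ^+ (0 < k)%N * E.
Proof.
have E0 : 0 <= E by exact: Efun_ge0.
elim: k => [|k [inj_k Ek]]; first by rewrite mul1r.
have lamk : 0 <= lambda ^+ (0 < k)%N <= 1.
  by rewrite exprn_ge0 ?exprn_ile1 ?lambda_ge0// ltW.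
have EkE : Efun p f (it k) <= E.
  by case/andP: lamk => _ lamk1; rewrite (le_trans Ek)// ler_piMl.
have KEk : K * Efun p f (it k) <= K * E by rewrite ler_wpM2l ?powR_ge0.
have KEk1 := le_lt_trans KEk KE1.
split; first exact: step_inj KEk1.
apply: le_trans (step_Efun _ _ _ _ _ _) _ => //.
rewrite expr1 ler_pM ?Efun_ge0//.
  by rewrite divr_ge0 ?subr_ge0 ?(ltW KEk1)// gain_ge0 ?Efun_ge0 ?Efun_lt1.
rewrite ler_pM ?invr_ge0 ?subr_ge0 ?(ltW KEk1)//.
- by rewrite gain_ge0 ?Efun_ge0 ?Efun_lt1.
- rewrite -[leRHS]mul1r ler_gain ?ler01 ?lexx ?Efun_ge0 ?mul1r ?Efun_lt1//.
- by rewrite lef_pV2 ?posrE ?subr_gt0// lerD2l lerN2.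
Qed.

(** The first step multiplies the correction by at most
    [gain E = theta * lambda].  The later ones start from [Efun <= lambda * E],
    so their factor is at most [lambda * gain E = mu]. *)
Lemma iter_weierstrass_le k i :
  normc (weierstrass f (it k.+1) i) <= theta * lambda * mu ^+ k * normc (W i).
Proof.
elim: k => [|k IH].
  rewrite mulr1 -gainE; exact: weierstrass_step_le.
have E0 : 0 <= E by exact: Efun_ge0.
have [inj_k Ek] := iter_invariant k.+1; rewrite expr1 in Ek.
have Ek0 : 0 <= Efun p f (it k.+1) by exact: Efun_ge0.
have EkE : Efun p f (it k.+1) <= E by rewrite (le_trans Ek)// ler_piMl// ltW.
have KEk : K * Efun p f (it k.+1) <= K * E by rewrite ler_wpM2l ?powR_ge0.
have KEk1 := le_lt_trans KEk KE1.
have g : gain n p (Efun p f (it k.+1)) <= mu.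
  have -> : mu = lambda * gain n p E by rewrite gainE /mu expr2; ring.
  by rewrite ler_gain ?lambda_ge0 ?Ek0 ?Efun_lt1// ltW.
apply: le_trans (weierstrass_step_le n2 p1 fmonic fsize inj_k KEk1 i) _.
apply: le_trans (ler_wpM2r (normc_ge0 _) g) _.
by rewrite exprS [_ * (mu * _)]mulrCA -!(mulrA mu) ler_wpM2l ?mu_ge0.
Qed.

(** The corrections after the first step are dominated by a geometric series
    with first term [theta * lambda * normc (W i)] and ratio [mu], whose sum is
    [C * normc (W i)]; the induction needs the partial sums. *)
Lemma iter_dist_le k i :
  normc (it k.+1 0 i - it 1 0 i) <= C * normc (W i).
Proof.
have mu1 : 0 < 1 - mu by rewrite subr_gt0 mu_lt1.
suff : normc (it k.+1 0 i - it 1 0 i) <= C * (1 - mu ^+ k) * normc (W i).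
  move/le_trans; apply; rewrite ler_wpM2r ?normc_ge0// ler_piMr ?C_ge0//.
  by rewrite lerBlDr lerDl exprn_ge0 ?mu_ge0.
elim: k => [|k IH]; first by rewrite subrr normc0 subrr mulr0 mul0r.
have -> : it k.+2 0 i - it 1 0 i =
    (it k.+1 0 i - it 1 0 i) - weierstrass f (it k.+1) i.
  by rewrite {1}/it iterS mxE -/(it k.+1); ring.
apply: le_trans (ler_normc_sub _ _) _.
apply: le_trans (lerD IH (iter_weierstrass_le k i)) _.
rewrite -mulrDl ler_wpM2r ?normc_ge0// le_eqVlt; apply/orP; left; apply/eqP.
by rewrite /C exprS; field; rewrite gt_eqF.
Qed.

Lemma exists_root_in_disk i :
  exists2 x, normc (x - (z0 0 i - W i)) <= C * normc (W i) & root f x.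
Proof.
apply: root_in_disk => // e e0.
(* [f] at the [i]-th point is its correction, which tends to 0, times a product
   of distances, which stays below [B] as no point leaves its disk. *)
have it1 j : it 1 0 j = z0 0 j - W j by rewrite /it /= mxE.
pose B : R := \prod_(j | j != i)
  (normc (it 1 0 i - it 1 0 j) + C * normc (W i) + C * normc (W j)).
have [|k ke] := @geometric_small R (theta * lambda * normc (W i) * B) mu e _ e0.
  by rewrite mu_ge0 mu_lt1.
exists (it k.+1 0 i); first by rewrite -it1 iter_dist_le.
have [inj_k _] := iter_invariant k.+1.
have -> : f.[it k.+1 0 i] = weierstrass f (it k.+1) i *
    \prod_(j | j != i) (it k.+1 0 i - it k.+1 0 j).
  rewrite divfK//; apply/prodf_neq0 => j ji.
  by rewrite subr_eq0; apply: contra ji => /eqP/inj_k ->.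
rewrite normcM normc_prod; apply: le_lt_trans ke.
rewrite mulrAC ler_pM ?normc_ge0//.
- by apply: prodr_ge0 => j _; exact: normc_ge0.
- by rewrite (le_trans (iter_weierstrass_le k i))// mulrAC.
apply: ler_prod => j _; rewrite normc_ge0/=.
have -> : it k.+1 0 i - it k.+1 0 j = (it 1 0 i - it 1 0 j) +
   (it k.+1 0 i - it 1 0 i) - (it k.+1 0 j - it 1 0 j) by ring.
apply: le_trans (ler_normc_sub _ _) _; rewrite lerD ?iter_dist_le//.
by apply: le_trans (ler_normc_add _ _) _; rewrite lerD2l iter_dist_le.
Qed.

(** The centres are at distance at least [theta * d], with [d] the distance of
    the two initial points, while the radii add up to at most
    [C * (1 - theta) * d].  The strict inequality [C * (1 - theta) < theta]
    amounts to [0 < (1 - lambda) * (1 + theta * lambda)]. *)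
Lemma disks_disjoint i j x : i != j ->
  normc (x - (z0 0 i - W i)) <= C * normc (W i) ->
  normc (x - (z0 0 j - W j)) <= C * normc (W j) -> False.
Proof.
rewrite eq_sym => ij xi xj.
have D0 := dist_gt0 n2 zinj ij.
have := step_dist f n2 p1 zinj ij.
have := weierstrass_pair_le f n2 p1 zinj ij.
rewrite !mxE -/W -/E -/K; set D := normc (z0 0 i - z0 0 j) in D0 *.
have -> : z0 0 i - W i - (z0 0 j - W j) =
  (x - (z0 0 j - W j)) - (x - (z0 0 i - W i)) by ring.
move=> pair /le_trans /(_ (ler_normc_sub _ _)) dist.
have {xi xj} le1 := le_trans dist (lerD xj xi).
have CKE : C * (1 - theta) < theta.
  have mu1 : 0 < 1 - mu by rewrite subr_gt0 mu_lt1.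
  rewrite -(mulrC (1 - theta)) mulrA ltr_pdivrMr//.
  have [t0 l0] := (theta_gt0, lambda_ge0).
  suff : theta * (1 - lambda + theta * lambda * (1 - lambda)) > 0.
    by move=> pos; rewrite -subr_gt0; congr (0 < _): pos; rewrite /mu; ring.
  have l1 : 0 < 1 - lambda by rewrite subr_gt0.
  by rewrite mulr_gt0// ltr_wpDr// mulr_ge0 ?(ltW l1)// mulr_ge0 ?(ltW t0).
have : theta * D <= C * (1 - theta) * D.
  rewrite (le_trans le1)// -mulrDr -mulrA ler_wpM2l ?C_ge0// addrC.
  by rewrite opprB subrKC.
by rewrite ler_pM2r// leNgt CKE.
Qed.

End Iteration.

(** * Simplicity and localisation of the zeros *)

Theorem theorem2p1 (R : realType) (n : nat) (f : {poly R[i]})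
    (p q : \bar R) (z0 : 'rV[R[i]]_n) :
  (2 <= n)%N ->
  f \is monic ->
  size f = n.+1 ->
  (1 <= p)%E ->
  (p^-1 + q^-1 = 1)%E ->
  injective (fun i : 'I_n => z0 0 i) ->
  Efun p f z0 < 1 / 2 `^ recip q ->
  phi n p q (Efun p f z0) < 1 ->
  let lambda := phi n p q (Efun p f z0) in
  let theta := 1 - 2 `^ recip q * Efun p f z0 in
  let C := theta * lambda / (1 - theta * lambda ^+ 2) in
  let D := fun i : 'I_n =>
    closed_disk (z0 0 i - weierstrass f z0 i)
                (C * normc (weierstrass f z0 i)) in
  only_simple_zeros f /\
  (forall i j : 'I_n, i != j -> D i `&` D j = set0) /\
  (forall i : 'I_n, exists! x : R[i], D i x /\ root f x).
Proof.
move=> n2 fmonic fsize p1 pq zinj E_lt phi_lt lambda theta C D.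
have KE1 : 2 `^ (1 - recip p) * Efun p f z0 < 1.
  by move: E_lt; rewrite (recip_conj p1 pq) ltr_pdivlMr ?powR_gt0// mulrC.
have lambda1 := phi_lt; rewrite (phi_gain _ _ p1 pq) in lambda1.
have rootD i : exists2 x, D i x & root f x.
  have := exists_root_in_disk n2 p1 fmonic fsize zinj KE1 lambda1 i.
  by rewrite -(phi_gain _ _ p1 pq) -(recip_conj p1 pq).
have disjD i j x : i != j -> D i x -> D j x -> False.
  have := disks_disjoint n2 p1 zinj KE1 lambda1 (i := i) (j := j) (x := x).
  by rewrite -(phi_gain _ _ p1 pq) -(recip_conj p1 pq).
pose x i := s2val (cid2 (rootD i)).
have xD i : D i (x i) := s2valP (cid2 (rootD i)).
have xroot i : root f (x i) := s2valP' (cid2 (rootD i)).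
have xinj : injective x.
  move=> i j xij; apply: contrapT => /eqP ij.
  by apply: (disjD _ _ _ ij (xD i)); rewrite xij.
have only := distinct_roots_only fmonic fsize xinj xroot.
split; first by move=> y /only[].
split=> [i j ij|i].
  by apply/seteqP; split=> // y [Diy Djy]; exact: disjD ij Diy Djy.
exists (x i); split; first by split.
move=> y [Diy /only[_ [j yxj]]]; rewrite yxj; have [-> //|ij] := eqVneq i j.
by case: (disjD _ _ _ ij Diy); rewrite yxj.
Qed.
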